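(* Let $p > 0$ be a real number and let $A$ be a complex $n \times n$ matrix whose spectrum belongs to $$\mathcal{P}_i = \left\{\lambda \in \mathbb{C} : (\mathrm{Im}\,\lambda)^2 < 2p\, \mathrm{Re}\, \lambda \right\}.$$ Let $H = H^* > 0$ be a solution to $$HA + A^*H - \frac{1}{2p}A^*HA + \frac{1}{4p}\left(HA^2+(A^* )^2H\right) = I.$$ If $B$ is a complex $n \times n$ matrix such that $$HB + B^*H - \frac{1}{2p}\left(A^*HB + B^*HA + B^*HB\right) + \frac{1}{4p}\left(H(AB + BA + B^2) + (AB + BA + B^2)^*H\right) > -I,$$ then the spectrum of the matrix $A + B$ also belongs to $\mathcal{P}_i$.
   Context: $M^*$ denotes the conjugate transpose of $M$, and $I$ is the $n\times n$ identity matrix. For Hermitian matrices $M, N$, $M > 0$ means that $M$ is positive definite and $M > N$ means that $M - N$ is positive definite. *)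

(* Defs.v *)
From HB Require Import structures.
From mathcomp Require Import all_boot all_order all_algebra.
From mathcomp Require Import sesquilinear spectral.
From mathcomp Require Import reals.
From mathcomp Require Import complex.

Set Implicit Arguments.
Unset Strict Implicit.
Unset Printing Implicit Defensive.

Import Order.TTheory GRing.Theory Num.Theory.
Local Open Scope ring_scope.
Local Open Scope complex_scope.
Local Open Scope sesquilinear_scope.

(* The strict order on R[i] forces the quadratic form to be real. *)
Definition posdefmx (R : realType) (n : nat) (M : 'M[R[i]]_n) : Prop :=
  M \is hermsymmx /\
  forall x : 'cV[R[i]]_n, x != 0 -> 0 < (x ^t* *m M *m x) 0 0.

Definition gtmx (R : realType) (n : nat) (M N : 'M[R[i]]_n) : Prop :=
  posdefmx (M - N).

Definition parabola_interior (R : realType) (p : R) : pred R[i] :=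
  fun lam => complex.Im lam ^+ 2 < 2 * p * complex.Re lam.

(* [eigenvalue] is defined through row eigenvectors; for a square matrix over
   a field column eigenvectors give the same set. *)
Definition spectrum_in (R : realType) (n : nat) (A : 'M[R[i]]_n)
    (S : pred R[i]) : Prop :=
  forall lam : R[i], eigenvalue A lam -> S lam.

(* Main.v *)
(** Write L(C) for the left-hand side of the Lyapunov equation with C in place
    of A.  The two hypotheses add up to L(A + B) > 0.  If C x = lam x, then
    x* L(C) x = (2 Re lam - (Im lam)^2 / p) (x* H x), because
    Re (lam^2) - |lam|^2 = - 2 (Im lam)^2; since x* H x > 0, positivity of L(C)
    puts lam inside the parabola. *)

Require Import Defs.
From HB Require Import structures.
From mathcomp Require Import all_boot all_order all_algebra.
From mathcomp Require Import sesquilinear spectral.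
From mathcomp Require Import reals complex ring.

Set Implicit Arguments.
Unset Strict Implicit.
Unset Printing Implicit Defensive.

Import Order.TTheory GRing.Theory Num.Theory.
Local Open Scope ring_scope.
Local Open Scope complex_scope.
Local Open Scope sesquilinear_scope.

(** A square matrix and its transpose are singular together, so [(C - lam%:M)^T] kills a nonzero row
    vector [v], and [v^T] is the eigenvector sought. *)
Lemma eigenvalue_colP (F : fieldType) (n : nat) (C : 'M[F]_n) (lam : F) :
  eigenvalue C lam -> exists2 x : 'cV[F]_n, x != 0 & C *m x = lam *: x.
Proof.
rewrite /eigenvalue /eigenspace kermx_eq0 row_free_unit => nu.
have: kermx (C - lam%:M)^T != 0 by rewrite kermx_eq0 row_free_unit unitmx_tr.
case/rowV0Pn=> v /sub_kermxP v0 vn0; exists v^T.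
  by apply: contra vn0 => /eqP v0'; rewrite -[v]trmxK v0' trmx0.
apply/eqP; rewrite -subr_eq0 -mul_scalar_mx -mulmxBl.
by rewrite -[C - _]trmxK -trmx_mul v0 trmx0.
Qed.

Lemma quad_form_eigenvector (R : realType) (n : nat) (p : R) (C H : 'M[R[i]]_n)
    (x : 'cV[R[i]]_n) (lam : R[i]) : p != 0 -> C *m x = lam *: x ->
  x ^t* *m (H *m C + C ^t* *m H - ((2 * p)^-1)%:C *: (C ^t* *m H *m C)
      + ((4 * p)^-1)%:C *: (H *m (C *m C) + (C ^t* *m C ^t*) *m H)) *m x
  = (2 * complex.Re lam - complex.Im lam ^+ 2 / p)%:C *: (x ^t* *m H *m x).
Proof.
move=> p0 Cx.
(* The adjoint of [Cx]: each [C ^t*] next to [x ^t*] becomes the scalar [lam^*], so every term below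
   is a multiple of [Q]. *)
have xC : x ^t* *m C ^t* = lam^* *: x ^t*.
  by rewrite -map_mxM -trmx_mul Cx linearZ /= map_mxZ.
set Q := x ^t* *m H *m x.
have e1 : x ^t* *m (H *m C) *m x = lam *: Q.
  by rewrite -!mulmxA Cx -!scalemxAr /Q mulmxA.
have e2 : x ^t* *m (C ^t* *m H) *m x = lam^* *: Q.
  by rewrite !mulmxA xC -!scalemxAl.
have e3 : x ^t* *m (C ^t* *m H *m C) *m x = (lam^* * lam) *: Q.
  by rewrite !mulmxA xC -!mulmxA Cx -!scalemxAl -!scalemxAr scalerA /Q !mulmxA.
have e4 : x ^t* *m (H *m (C *m C)) *m x = (lam * lam) *: Q.
  by rewrite -!mulmxA Cx -!scalemxAr Cx -!scalemxAr scalerA /Q !mulmxA.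
have e5 : x ^t* *m (C ^t* *m C ^t* *m H) *m x = (lam^* * lam^*) *: Q.
  by rewrite !mulmxA xC -!scalemxAl xC -!scalemxAl scalerA.
rewrite mulmxDr mulmxBr -!scalemxAr !mulmxDr mulmxDl mulmxBl -!scalemxAl !mulmxDl.
rewrite e1 e2 e3 e4 e5 -!scalerDl !scalerA -scalerBl -scalerDl; congr (_ *: _).
(* Only the scalar coefficients of [Q] remain; with [lam] = a + ib the imaginary parts cancel and
   the real parts agree. *)
case: lam {Cx xC e1 e2 e3 e4 e5} => a b; apply/eqP; rewrite eq_complex /=.
by apply/andP; split; apply/eqP; field.
Qed.

Theorem theorem10 (R : realType) (n : nat) (p : R) (A H B : 'M[R[i]]_n)
  (hp : 0 < p)
  (hA : spectrum_in A (parabola_interior p))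
  (hH : posdefmx H)
  (hLyap :
     H *m A + A ^t* *m H
     - ((2 * p)^-1)%:C *: (A ^t* *m H *m A)
     + ((4 * p)^-1)%:C *: (H *m (A *m A) + (A ^t* *m A ^t*) *m H)
     = 1%:M)
  (hB :
     gtmx
       (H *m B + B ^t* *m H
        - ((2 * p)^-1)%:C *:
            (A ^t* *m H *m B + B ^t* *m H *m A + B ^t* *m H *m B)
        + ((4 * p)^-1)%:C *:
            (H *m (A *m B + B *m A + B *m B)
             + (A *m B + B *m A + B *m B) ^t* *m H))
       (- 1%:M)) :
  spectrum_in (A + B) (parabola_interior p).
Proof.
move=> lam /eigenvalue_colP [x x0 Cx].
case: hB => _ /(_ x x0); set M := (M in x ^t* *m M *m x).
have -> : M = H *m (A + B) + (A + B) ^t* *m H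
     - ((2 * p)^-1)%:C *: ((A + B) ^t* *m H *m (A + B))
     + ((4 * p)^-1)%:C *: (H *m ((A + B) *m (A + B))
         + ((A + B) ^t* *m (A + B) ^t*) *m H).
  (* Subtracting [- 1%:M] adds the identity, which [hLyap] read backwards turns into L(A). *)
  rewrite /M opprK -hLyap !linearD /= !map_mxD !trmx_mul !map_mxM.
  rewrite !(mulmxDl, mulmxDr, mulmxA).
  (* With the noncommutative products generalized to atoms, the identity is
     linear and [ring] proves it entrywise. *)
  repeat match goal with |- context [?X *m ?Y] => move: (X *m Y) => ? end.
  by apply/matrixP=> i j; rewrite !mxE; ring.
rewrite (quad_form_eigenvector _ (lt0r_neq0 hp) Cx) mxE.
(* Dividing out x* H x > 0 leaves a real inequality; multiplying it by [p] gives the parabola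
   condition. *)
case: hH => _ /(_ x x0) Q0; rewrite pmulr_lgt0 // ltcR subr_gt0 ltr_pdivrMr //.
by rewrite mulrAC.
Qed.
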